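(* The function $\zeta:\mathbb{R}\to\mathbb{R}$ defined by $$\zeta(\delta)=\max\big\{g(\delta+a_s x)-\rho_s(k)(x-k)-g(ka_s) : x\in\mathbb{Z},\ 0\le x\le\mu_s\big\}$$ is subadditive on $\mathbb{R}_+=[0,\infty)$ and on $\mathbb{R}_-=(-\infty,0]$ separately.
   Context: Let $n\ge 1$, let $f:\mathbb{R}\to\mathbb{R}$ be concave, let $a\in\mathbb{R}^n$ with $a_i\ge 0$ for all $i$, and let $\mu\in\mathbb{Z}^n$ with all $\mu_i\ge 1$. Fix $s\in\{1,\dots,n\}$ with $a_s>0$, disjoint subsets $S_0,S_1$ of $\{1,\dots,n\}\setminus\{s\}$ with $\{s\}\cup S_0\cup S_1=\{1,\dots,n\}$, and an integer $k\in\{1,\dots,\mu_s\}$. Define $g(z)=f\big(z+\sum_{i\in S_1}\mu_i a_i\big)$ and $\rho_s(k)=g(ka_s)-g((k-1)a_s)$. A function $h$ is subadditive on $D$ if $h(\delta_1)+h(\delta_2)\ge h(\delta_1+\delta_2)$ for all $\delta_1,\delta_2\in D$ with $\delta_1+\delta_2\in D$. *)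

(* Defs.v *)
From HB Require Import structures.
From mathcomp Require Import all_boot all_order all_algebra.
From mathcomp Require Import boolp classical_sets set_interval reals.
From mathcomp Require Import interval_inference convex.

Set Implicit Arguments.
Unset Strict Implicit.
Unset Printing Implicit Defensive.
Import Order.TTheory GRing.Theory Num.Theory.
Local Open Scope classical_set_scope.
Local Open Scope ring_scope.

Definition concave_function (R : realType) (f : R -> R) : Prop :=
  @convex_function R R^o [set: convex_lmodType R^o] (fun x => - f x).

Definition subadditive_on (R : realType) (D : set R) (h : R -> R) : Prop :=
  forall d1 d2, D d1 -> D d2 -> D (d1 + d2) -> h d1 + h d2 >= h (d1 + d2).

Definition g (R : realType) (n : nat) (f : R -> R) (a : 'I_n -> R)
    (mu : 'I_n -> int) (S1 : {set 'I_n}) (z : R) : R :=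
  f (z + \sum_(i in S1) (mu i)%:~R * a i).

Definition rho (R : realType) (n : nat) (f : R -> R) (a : 'I_n -> R)
    (mu : 'I_n -> int) (S1 : {set 'I_n}) (s : 'I_n) (k : int) : R :=
  g f a mu S1 (k%:~R * a s) - g f a mu S1 ((k - 1)%:~R * a s).

Definition zeta_term (R : realType) (n : nat) (f : R -> R) (a : 'I_n -> R)
    (mu : 'I_n -> int) (S1 : {set 'I_n}) (s : 'I_n) (k : int)
    (delta : R) (x : int) : R :=
  g f a mu S1 (delta + a s * x%:~R) - rho f a mu S1 s k * (x - k)%:~R
    - g f a mu S1 (k%:~R * a s).

(* The seed of the iterated maximum is the term at x = 0, one of the terms
   being maximized; see zeta_max for the characterization as a maximum over
   the integers 0 <= x <= mu s. *)
Definition zeta (R : realType) (n : nat) (f : R -> R) (a : 'I_n -> R)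
    (mu : 'I_n -> int) (S1 : {set 'I_n}) (s : 'I_n) (k : int)
    (delta : R) : R :=
  let F := zeta_term f a mu S1 s k delta in
  \big[Num.max/F 0]_(0 <= x < `|mu s|%N.+1) F x%:Z.

Lemma concave_functionP (R : realType) (f : R -> R) :
  concave_function f <->
  forall t x y : R, 0 <= t <= 1 ->
    t * f x + (1 - t) * f y <= f (t * x + (1 - t) * y).
Proof.
split=> [cf t x y /andP[t0 t1]|cf t x y _ _].
  have := cf (Itv01 t0 t1) x y (in_setT _) (in_setT _).
  by rewrite [X in _ <= X -> _]convRE /= !mulrN -opprD lerN2.
rewrite [X in _ <= X]convRE /= !mulrN -opprD lerN2.
by apply: cf; rewrite ge0 le1.
Qed.

Lemma zeta_max (R : realType) (n : nat) (f : R -> R) (a : 'I_n -> R)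
    (mu : 'I_n -> int) (S1 : {set 'I_n}) (s : 'I_n) (k : int) (delta : R) :
  0 <= mu s ->
  (exists2 x : int, 0 <= x <= mu s &
     zeta f a mu S1 s k delta = zeta_term f a mu S1 s k delta x) /\
  (forall x : int, 0 <= x <= mu s ->
     zeta_term f a mu S1 s k delta x <= zeta f a mu S1 s k delta).
Proof.
move=> mu0; rewrite /zeta; set F := zeta_term _ _ _ _ _ _ _.
split; last first.
  move=> [x|x] // /andP[_ xm].
  apply: (le_bigmax_seq _ x xpredT (fun i : nat => F i%:Z)) => //.
  by rewrite mem_index_iota /= ltnS -lez_nat gez0_abs.
rewrite big_seq; elim/big_ind: _.
- by exists 0 => //; rewrite lexx.
- by move=> u v Hu Hv; case: (leP u v).
- move=> x; rewrite mem_index_iota /= ltnS -lez_nat gez0_abs// => xm.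
  by exists x%:Z.
Qed.

(* Main.v *)
(** Put [G := g], [a := a s], and let [y := d1 + d2 + a x] be the point at which
    the maximum defining [zeta (d1 + d2)] is attained. It suffices to find
    admissible integers [x1], [x2] whose points [u := d1 + a x1] and
    [v := d2 + a x2] satisfy [u + v = y + q], with [u] between [y] and [q], where
    [q] is [k a] or [(k - 1) a]: concavity gives [G y + G q <= G u + G v], and
    [rho] is exactly the slope that makes both choices of [q] give the same
    inequality between the maximized terms. For nonnegative arguments, if
    [d1 + a x >= k a], take [x1 = x] and [x2 = k]; otherwise choose [x1] so
    that [u] falls in the window from [(k - 1) a] to [k a], and [q] according to
    the side of [y] on which [u] lies. Nonpositive arguments are treated by the
    mirror image of this choice. *)
Require Import Defs.
From mathcomp Require Import all_boot all_order all_algebra.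
From mathcomp Require Import boolp classical_sets set_interval reals.
From mathcomp Require Import zify ring lra.

Import Order.TTheory GRing.Theory Num.Theory.
Local Open Scope ring_scope.

(** As [v] mirrors [u] in the midpoint of [p] and [q], the two are convex combinations of [p] and
    [q] with swapped weights; adding both concavity inequalities gives the claim. *)
Lemma concave_exchange {R : realType} {f : R -> R} {p q u v : R} :
  concave_function f -> p <= u <= q -> u + v = p + q ->
  f p + f q <= f u + f v.
Proof.
move=> /concave_functionP cf /andP[pu uq] uv.
have [pq|pq] := eqVneq p q.
  have up : u = p by lra.
  have vq : v = q by lra.
  by rewrite up vq.
have qp0 : 0 < q - p by rewrite subr_gt0 lt_neqAle pq (le_trans pu uq).
have qpn0 : q - p != 0 by rewrite gt_eqF.
pose t := (q - u) / (q - p).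
have t01 : 0 <= t <= 1.
  rewrite /t ler_pdivrMr // mul1r; apply/andP; split; last lra.
  by apply: divr_ge0; lra.
have t01' : 0 <= 1 - t <= 1 by lra.
have uE : t * p + (1 - t) * q = u by rewrite /t; field.
have vE : (1 - t) * p + (1 - (1 - t)) * q = v.
  have -> : v = p + q - u by lra.
  by rewrite -uE; ring.
have := cf _ p q t01; have := cf _ p q t01'.
rewrite uE vE => h1 h2; lra.
Qed.

Lemma g_concave (R : realType) (n : nat) (f : R -> R) (a : 'I_n -> R)
    (mu : 'I_n -> int) (S1 : {set 'I_n}) :
  concave_function f -> concave_function (g f a mu S1).
Proof.
move=> /concave_functionP cf; apply/concave_functionP => t x y t01.
rewrite /g; set c := (X in f (x + X)).
have -> : t * x + (1 - t) * y + c = t * (x + c) + (1 - t) * (y + c) by ring.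
exact: cf.
Qed.

Section Subadditivity.
Variables (R : realType) (n : nat) (f : R -> R) (a : 'I_n -> R).
Variables (mu : 'I_n -> int) (S1 : {set 'I_n}) (s : 'I_n) (k : int).
Hypothesis cf : concave_function f.

Let F := zeta_term f a mu S1 s k.

(** For [j = k] the [rho] terms cancel. For [j = k - 1] one [rho] is left over, and it turns
    [G (k a)] into [G ((k - 1) a)]. *)
Lemma zeta_term_exchange (d1 d2 : R) (x x1 x2 j : int) :
  j = k \/ j = k - 1 -> x1 + x2 = x + j ->
  let y := d1 + d2 + a s * x%:~R in
  let q := j%:~R * a s in
  let u := d1 + a s * x1%:~R in
  (q <= u <= y) || (y <= u <= q) ->
  F (d1 + d2) x <= F d1 x1 + F d2 x2.
Proof.
move=> jk xE y q u uyq.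
have x2E : x2 = x + j - x1 by lia.
set v := d2 + a s * x2%:~R.
have uv : u + v = y + q.
  by rewrite /u /v /y /q x2E !rmorphB !rmorphD /=; ring.
have cg : concave_function (g f a mu S1) by exact: g_concave.
have G : g f a mu S1 y + g f a mu S1 q <= g f a mu S1 u + g f a mu S1 v.
  case/orP: uyq => [H|H]; last exact: (concave_exchange cg H).
  rewrite addrC; apply: (concave_exchange cg H); lra.
rewrite /F /zeta_term -/y -/u -/v x2E.
case: jk => jE.
- rewrite /q jE in G *.
  have -> : (x + k - x1 - k)%:~R = (x - k)%:~R - (x1 - k)%:~R :> R.
    by rewrite -rmorphB; congr (_ %:~R); lia.
  rewrite mulrBr; lra.
- rewrite /q jE in G *.
  have -> : (x + (k - 1) - x1 - k)%:~R = (x - k)%:~R - (x1 - k)%:~R - 1 :> R.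
    by rewrite !(rmorphB, rmorphD) /=; ring.
  have rE : rho f a mu S1 s k
      = g f a mu S1 (k%:~R * a s) - g f a mu S1 ((k - 1)%:~R * a s) by [].
  rewrite !mulrBr mulr1; lra.
Qed.

Hypothesis (as_gt0 : 0 < a s) (hk : 1 <= k <= mu s).

Lemma zeta_subadditive_of_terms (D : set R) :
  (forall d1 d2 x, D d1 -> D d2 -> 0 <= x <= mu s ->
     exists x1 x2, [/\ 0 <= x1 <= mu s, 0 <= x2 <= mu s &
       F (d1 + d2) x <= F d1 x1 + F d2 x2]) ->
  subadditive_on D (zeta f a mu S1 s k).
Proof.
move=> H d1 d2 D1 D2 _.
have mu0 : 0 <= mu s by lia.
have zM d := zeta_max f a S1 k d mu0.
have [[x x01 ->] _] := zM (d1 + d2).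
have [x1 [x2 [hx1 hx2 hF]]] := H d1 d2 x D1 D2 x01.
by apply: le_trans hF _; apply: lerD; [apply: (zM d1).2|apply: (zM d2).2].
Qed.

Lemma zeta_subadditive_ge0 :
  subadditive_on `[0, +oo[%classic (zeta f a mu S1 s k).
Proof.
apply: zeta_subadditive_of_terms => d1 d2 x /=.
rewrite !in_itv /= !andbT => d10 d20 x01.
have [kx|xk] := leP (k%:~R * a s) (d1 + a s * x%:~R).
  exists x, k; split=> //; first lia.
  apply: (zeta_term_exchange _ _ _ _ _ k) => //; first by left.
  by apply/orP; left; rewrite kx /=; lra.
(* Since [d1 - m a] lies in [[0, a)], the choice [x1 = k - 1 - m] puts [u] in [[(k - 1) a, k a)]. *)
pose m := Num.floor (d1 / a s).
have m0 : 0 <= m by rewrite floor_ge0 divr_ge0 // ltW.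
have /andP[md dm] := floor_itv (d1 / a s).
rewrite -/m ler_pdivlMr // in md; rewrite -/m ltr_pdivrMr // rmorphD /= in dm.
(* This gives admissibility: [x <= k - 1 - m] and [x + m + 1 <= k]. *)
have mxk : x + m < k.
  rewrite -(ltr_int R) -(ltr_pM2r as_gt0) rmorphD /=; lra.
have uE : d1 + a s * (k - 1 - m)%:~R = d1 + (k%:~R - 1 - m%:~R) * a s.
  by rewrite !rmorphB /= mulrC.
have [uy|yu] := leP (d1 + a s * (k - 1 - m)%:~R) (d1 + d2 + a s * x%:~R).
- exists (k - 1 - m), (x + m); split; try lia.
  apply: (zeta_term_exchange _ _ _ _ _ (k - 1)); [by right|lia|].
  by apply/orP; left; rewrite uy uE rmorphB /=; lra.
- exists (k - 1 - m), (x + m + 1); split; try lia.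
  apply: (zeta_term_exchange _ _ _ _ _ k); [by left|lia|].
  by apply/orP; right; rewrite (ltW yu) uE /=; lra.
Qed.

Lemma zeta_subadditive_le0 :
  subadditive_on `]-oo, 0]%classic (zeta f a mu S1 s k).
Proof.
apply: zeta_subadditive_of_terms => d1 d2 x /=.
rewrite !in_itv /= => d10 d20 x01.
have [xk|kx] := leP (d1 + a s * x%:~R) ((k - 1)%:~R * a s).
  (* [k - 1] is admissible as [1 <= k], and [y = u + d2 <= u]. *)
  exists x, (k - 1); split=> //; first lia.
  apply: (zeta_term_exchange _ _ _ _ _ (k - 1)) => //; first by right.
  by apply/orP; right; rewrite xk andbT; lra.
(* Now [d1 + m a] lies in [(-a, 0]], so [x1 = k + m] puts [u] in [((k - 1) a, k a]]. *)
pose m := Num.floor (- d1 / a s).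
have m0 : 0 <= m by rewrite floor_ge0 divr_ge0 ?oppr_ge0 // ltW.
have /andP[md dm] := floor_itv (- d1 / a s).
rewrite -/m ler_pdivlMr // in md; rewrite -/m ltr_pdivrMr // rmorphD /= in dm.
rewrite rmorphB /= in kx.
(* Hence [k + m <= x <= mu s], and [x - m - 1 >= k - 1 >= 0]. *)
have kmx : k - 1 < x - m.
  rewrite -(ltr_int R) -(ltr_pM2r as_gt0) !rmorphB /=; lra.
have uE : d1 + a s * (k + m)%:~R = d1 + (k%:~R + m%:~R) * a s.
  by rewrite !rmorphD /= mulrC.
have [yu|uy] := leP (d1 + d2 + a s * x%:~R) (d1 + a s * (k + m)%:~R).
- exists (k + m), (x - m); split; try lia.
  apply: (zeta_term_exchange _ _ _ _ _ k); [by left|lia|].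
  by apply/orP; right; rewrite yu uE /=; lra.
- exists (k + m), (x - m - 1); split; try lia.
  apply: (zeta_term_exchange _ _ _ _ _ (k - 1)); [by right|lia|].
  by apply/orP; left; rewrite (ltW uy) uE rmorphB /= andbT; lra.
Qed.

End Subadditivity.

Theorem proposition4p1 (R : realType) (n : nat) (hn : (1 <= n)%N)
    (f : R -> R) (hf : concave_function f)
    (a : 'I_n -> R) (ha : forall i, 0 <= a i)
    (mu : 'I_n -> int) (hmu : forall i, 1 <= mu i)
    (s : 'I_n) (has_pos : 0 < a s)
    (S0 S1 : {set 'I_n})
    (hS0 : S0 \subset [set~ s]) (hS1 : S1 \subset [set~ s])
    (hdisj : [disjoint S0 & S1])
    (hcover : ([set s] :|: S0 :|: S1) = [set: 'I_n])
    (k : int) (hk : 1 <= k <= mu s) :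
  subadditive_on `[0, +oo[%classic (zeta f a mu S1 s k) /\
  subadditive_on `]-oo, 0]%classic (zeta f a mu S1 s k).
Proof.
by split; [apply: zeta_subadditive_ge0|apply: zeta_subadditive_le0].
Qed.
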